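(* Let $n\ge 4$ and let $\mathscr{U}_n$ be the set of all bipartite unicyclic graphs on $n$ vertices. (i) For every $G\in\mathscr{U}_n$, $\operatorname{per} L(G)\ge 24n-60$, with equality if and only if $G\cong B(2,n-2)$. (ii) If $n\ge 6$, then for every $G\in\mathscr{U}_n$ not isomorphic to $B(2,n-2)$, $\operatorname{per} L(G)\ge 40n-140$, with equality if and only if $G\cong C_4(1^10,1^00,1^{n-5}0,1^00)$. (iii) If $n\ge 6$, then for every $G\in\mathscr{U}_n$ isomorphic to neither $B(2,n-2)$ nor $C_4(1^10,1^00,1^{n-5}0,1^00)$, $\operatorname{per} L(G)\ge 44n-160$, with equality if and only if $G\cong B(3,n-3)$.
   Context: For a simple graph $G$, $L(G)=D(G)-A(G)$ is its Laplacian matrix ($D(G)$ the diagonal degree matrix, $A(G)$ the adjacency matrix), and $\operatorname{per} X=\sum_{\sigma\in S_n}\prod_{t=1}^n x_{t\sigma(t)}$ is the permanent. A unicyclic graph is a connected graph with the same number of vertices and edges. For nonnegative integers $s_i,k_i$, $C_4(1^{s_1}k_1,1^{s_2}k_2,1^{s_3}k_3,1^{s_4}k_4)$ is the graph obtained from the 4-cycle $v_1v_2v_3v_4v_1$ by attaching $s_i$ pendant vertices at $v_i$ and, when $k_i\ge 1$, joining $v_i$ by an edge to the center of a star on $k_i$ vertices (nothing further when $k_i=0$). For $2\le p\le q$, $B(p,q)=C_4(1^{p-2}0,1^{q-2}0,1^00,1^00)$, i.e. the 4-cycle with $p-2$ pendant vertices at $v_1$ and $q-2$ pendant vertices at $v_2$.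 *)

(* Defs.v *)
From mathcomp Require Import all_boot all_order all_algebra all_fingroup.
Set Implicit Arguments. Unset Strict Implicit. Unset Printing Implicit Defensive.
Import GRing.Theory Num.Theory.

Definition simple_graph (T : finType) (G : rel T) : Prop :=
  (forall x y, G x y = G y x) /\ (forall x, ~~ G x x).

Definition connected_graph (T : finType) (G : rel T) : Prop :=
  forall x y, connect G x y.

Definition nedges (n : nat) (G : rel 'I_n) : nat :=
  #|[set p : 'I_n * 'I_n | (p.1 < p.2)%N && G p.1 p.2]|.

Definition unicyclic (n : nat) (G : rel 'I_n) : Prop :=
  connected_graph G /\ nedges G = n.

Definition bipartite (T : finType) (G : rel T) : Prop :=
  exists c : T -> bool, forall x y, G x y -> c x != c y.

Definition graph_iso (T1 T2 : finType) (G1 : rel T1) (G2 : rel T2) : Prop :=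
  exists f : T1 -> T2, bijective f /\ forall x y, G2 (f x) (f y) = G1 x y.

Definition deg (T : finType) (G : rel T) (x : T) : nat := #|[set y | G x y]|.

Definition laplacian (n : nat) (G : rel 'I_n) : 'M[int]_n :=
  (\matrix_(i, j) (if i == j then Posz (deg G i) else - Posz (G i j : nat)))%R.

Definition per (R : comNzRingType) (n : nat) (A : 'M[R]_n) : R :=
  (\sum_(s : 'S_n) \prod_(i < n) A i (s i))%R.

(* C_4(1^{s1}k1, 1^{s2}k2, 1^{s3}k3, 1^{s4}k4): cycle on vertices 0,1,2,3
   (v_1..v_4), then for each v_i in turn, s_i pendant vertices, and (if k_i >= 1)
   a star on k_i vertices whose center is joined to v_i. *)
Definition attach (i s k c : nat) : seq (nat * nat) :=
  [seq (i, c + j) | j <- iota 0 s] ++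
  (if k is k'.+1 then (i, c + s) :: [seq (c + s, c + s + 1 + j) | j <- iota 0 k']
   else [::]).

Definition C4size (s1 k1 s2 k2 s3 k3 s4 k4 : nat) : nat :=
  4 + s1 + k1 + s2 + k2 + s3 + k3 + s4 + k4.

Definition C4edges (s1 k1 s2 k2 s3 k3 s4 k4 : nat) : seq (nat * nat) :=
  [:: (0, 1); (1, 2); (2, 3); (3, 0)] ++
  attach 0 s1 k1 4 ++
  attach 1 s2 k2 (4 + s1 + k1) ++
  attach 2 s3 k3 (4 + s1 + k1 + s2 + k2) ++
  attach 3 s4 k4 (4 + s1 + k1 + s2 + k2 + s3 + k3).

Definition C4graph (s1 k1 s2 k2 s3 k3 s4 k4 : nat) :
  rel 'I_(C4size s1 k1 s2 k2 s3 k3 s4 k4) :=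
  fun x y => ((nat_of_ord x, nat_of_ord y) \in C4edges s1 k1 s2 k2 s3 k3 s4 k4)
          || ((nat_of_ord y, nat_of_ord x) \in C4edges s1 k1 s2 k2 s3 k3 s4 k4).

Arguments C4graph s1 k1 s2 k2 s3 k3 s4 k4 x y : clear implicits.

Definition Bgraph (p q : nat) := C4graph (p - 2) 0 (q - 2) 0 0 0 0 0.
Arguments Bgraph p q x y : clear implicits.

(* Main.v *)
(** The Laplacian of a bipartite graph is conjugate, by a diagonal matrix of
    signs, to its entrywise absolute value, so its permanent is a permanent of
    natural numbers, for which restricting the set of permutations gives lower
    bounds.  If [v] is a leaf attached to [u] in [G = H + v], then
      [per L(G) = per L(H) + 2 per L_u(H)],
    where [L_u(H)] is [L(H)] without the row and column of [u].  A second
    induction on leaves shows that [per L_u(H)] is 12, 20 or 22 when [H] is a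
    4-cycle through [u] all of whose further vertices are pendants at [u],
    except possibly one, which is then a pendant at the opposite vertex (20) or
    at a neighbour of [u] on the cycle (22); in all other cases
    [per L_u(H) >= 28].  These values make the recursion reproduce exactly the
    three extremal families and make all other graphs strictly larger. *)
Require Import Defs.
From mathcomp Require Import all_boot all_order all_algebra all_fingroup.
From mathcomp Require Import zify.
Import GRing.Theory Num.Theory.

Set Implicit Arguments. Unset Strict Implicit. Unset Printing Implicit Defensive.

(** * Permanents of principal submatrices with natural entries *)

Section Permanent.
Variable T : finType.
Implicit Types (A B : T -> T -> nat) (S : {set T}).

(** Permutations of [T] fixing every point outside [S] stand for permutations of [S], so rows and
    columns keep their names when indices are deleted. *)
Definition sub_per A S : nat := \sum_(s : {perm T} | perm_on S s) \prod_(i in S) A i (s i).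

Lemma eq_sub_per A B S :
  (forall i j, i \in S -> j \in S -> A i j = B i j) -> sub_per A S = sub_per B S.
Proof.
move=> eqAB; apply: eq_bigr => s sS; apply: eq_bigr => i iS.
by rewrite eqAB // perm_closed.
Qed.

Lemma sub_per0 A : sub_per A set0 = 1.
Proof.
rewrite /sub_per (big_pred1 1%g) => [|s]; first by rewrite big_set0.
apply/idP/eqP => [sS|->]; last exact: perm_on1.
by apply/permP => x; rewrite perm1 (out_perm sS) ?inE.
Qed.

Lemma sub_per_tr A S : sub_per (fun i j => A j i) S = sub_per A S.
Proof.
rewrite /sub_per (reindex_inj invg_inj) /=.
have onV (s : {perm T}) : perm_on S s^-1%g = perm_on S s.
  by apply/idP/idP => /perm_onV //; rewrite invgK.
rewrite (eq_bigl _ _ onV).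
apply: eq_bigr => s sS; rewrite (reindex_inj (@perm_inj _ s)) /=.
rewrite (eq_bigl (mem S)) => [|i /=]; last exact: perm_closed.
by apply: eq_bigr => i _; rewrite permK.
Qed.

(** The bijection behind row expansion: composing with [tperm v a] matches the permutations of
    [S :\ v] with those of [S] sending [v] to [a]. *)
Lemma perm_on_mul_tperm S v a (s : {perm T}) : v \in S -> a \in S ->
  perm_on S (s * tperm v a)%g && ((s * tperm v a)%g v == a) = perm_on (S :\ v) s.
Proof.
move=> vS aS.
have tS : perm_on S (tperm v a).
  by apply/subsetP => x; rewrite inE; case: tpermP => [->|->|_ _]; rewrite ?eqxx.
apply/andP/idP => [[stS /eqP stv]|sS].
  have sS : perm_on S s by rewrite -[s](mulgK (tperm v a)) perm_onM ?perm_onV.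
  have sv : s v = v by apply: (@perm_inj _ (tperm v a)); rewrite tpermL -permM.
  apply/subsetP => x; rewrite !inE => sx; apply/andP; split.
    by apply: contraNneq sx => ->; rewrite sv.
  by apply: (subsetP sS).
split; last by rewrite permM (out_perm sS) ?tpermL // !inE eqxx.
by rewrite perm_onM //; apply: subset_trans sS (subsetDl _ _).
Qed.

(** Laplace expansion along row [v]. For [a != v] the minor without row [v] and column [a] is not
    principal; exchanging columns [v] and [a] turns it into a principal one on [S :\ v]. *)
Lemma sub_per_row A S v : v \in S ->
  sub_per A S = \sum_(a in S) A v a * sub_per (fun i j => A i (tperm v a j)) (S :\ v).
Proof.
move=> vS; rewrite /sub_per (partition_big (fun s : {perm T} => s v) (mem S)) /=; last first.
  by move=> s sS; rewrite perm_closed.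
apply: eq_bigr => a aS; rewrite big_distrr /= (reindex_inj (mulIg (tperm v a))) /=.
rewrite (eq_bigl _ _ (fun s => perm_on_mul_tperm s vS aS)).
apply: eq_bigr => s sS; rewrite (big_setD1 v) //=; congr (_ * _).
  by rewrite permM (out_perm sS) ?tpermL // !inE eqxx.
by apply: eq_bigr => i _; rewrite permM.
Qed.

Lemma sub_per_row1 A S v : v \in S -> (forall i, i \in S -> i != v -> A v i = 0) ->
  sub_per A S = A v v * sub_per A (S :\ v).
Proof.
move=> vS A0; rewrite (sub_per_row A vS) (bigD1 v) //= big1 ?addn0; last first.
  by move=> i /andP[iS iv]; rewrite A0.
by congr (_ * _); apply: eq_sub_per => i j _ _; rewrite tperm1 perm1.
Qed.

Lemma sub_per_col1 A S v : v \in S -> (forall i, i \in S -> i != v -> A i v = 0) ->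
  sub_per A S = A v v * sub_per A (S :\ v).
Proof. by move=> vS A0; rewrite -sub_per_tr (sub_per_row1 vS) // sub_per_tr. Qed.

Lemma sub_per_swap A S v u : 
  sub_per (fun i j => A i (tperm v u j)) (S :\ v :\ u) = sub_per A (S :\ v :\ u).
Proof.
apply: eq_sub_per => i j _; rewrite !inE => /and3P[ju jv _].
by rewrite tpermD // eq_sym.
Qed.

(** A permutation with nonzero product either fixes [v] or exchanges [v] and [u]. *)
Lemma sub_per_leaf A S v u : v \in S -> u \in S -> u != v ->
  (forall i, i \in S -> i != v -> i != u -> A v i = 0 /\ A i v = 0) ->
  sub_per A S = A v v * sub_per A (S :\ v) + A v u * A u v * sub_per A (S :\ v :\ u).
Proof.
move=> vS uS uv A0; rewrite (sub_per_row A vS) (bigD1 v) //= (bigD1 u) /=; last by rewrite uS.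
rewrite big1 => [|i /andP[/andP[iS iv] iu]]; last by have [-> _] := A0 i iS iv iu.
rewrite addn0; congr (_ * _ + _).
  by apply: eq_sub_per => i j _ _; rewrite tperm1 perm1.
rewrite -mulnA; congr (_ * _); rewrite (@sub_per_col1 _ _ u) ?inE ?uv //.
  by rewrite tpermR sub_per_swap.
by move=> i; rewrite !inE tpermR => /andP[iv iS] iu; have [_ ->] := A0 i iS iv iu.
Qed.

Lemma sub_per_diag_ge A S v : v \in S -> A v v * sub_per A (S :\ v) <= sub_per A S.
Proof.
move=> vS; rewrite (sub_per_row A vS) (bigD1 v) //=.
rewrite (@eq_sub_per _ A) ?leq_addr // => i j _ _.
by rewrite tperm1 perm1.
Qed.

(** Keeps only the permutations that fix [v] or exchange it with one other index; the dropped terms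
    are nonnegative. *)
Lemma sub_per_ge A S v : v \in S ->
  A v v * sub_per A (S :\ v) +
  \sum_(u in S :\ v) A v u * A u v * sub_per A (S :\ v :\ u) <= sub_per A S.
Proof.
move=> vS; rewrite (sub_per_row A vS) [X in _ <= X](bigD1 v) //=; apply: leq_add.
  rewrite (@eq_sub_per (fun i j => A i (tperm v v j)) A) // => i j _ _.
  by rewrite tperm1 perm1.
rewrite [X in _ <= X](eq_bigl (mem (S :\ v))) => [|u]; last by rewrite /= !inE andbC.
apply: leq_sum => u uS; rewrite -mulnA leq_mul2l; apply/orP; right.
have := sub_per_diag_ge (fun i j => A i (tperm v u j)) uS.
by rewrite tpermR sub_per_swap.
Qed.

(** Linearity in row [v], for a diagonal entry raised by one. A new leaf has this effect at its
    neighbour. *)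
Lemma sub_per_row_add A B S v : v \in S ->
  (forall i j, i \in S -> i != v -> A i j = B i j) ->
  (forall j, j \in S -> B v j = A v j + (j == v)) ->
  sub_per B S = sub_per A S + sub_per A (S :\ v).
Proof.
move=> vS eqAB Bv; rewrite !(sub_per_row _ vS).
transitivity (\sum_(a in S)
   (A v a + (a == v)) * sub_per (fun i j => A i (tperm v a j)) (S :\ v)).
  apply: eq_bigr => a aS; rewrite Bv //; congr (_ * _); apply: eq_sub_per => i j.
  by rewrite !inE => /andP[iv iS] _; rewrite eqAB.
under eq_bigr do rewrite mulnDl.
rewrite big_split /=; congr (_ + _); rewrite (bigD1 v) //= eqxx mul1n big1 ?addn0.
  by apply: eq_sub_per => i j _ _; rewrite tperm1 perm1.
by move=> i /andP[_ /negbTE ->].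
Qed.

Lemma sub_per1 A x : sub_per A [set x] = A x x.
Proof.
rewrite (@sub_per_row1 _ _ x) ?inE // => [|i]; last by rewrite inE => /eqP ->; rewrite eqxx.
by rewrite setDv sub_per0 muln1.
Qed.

Lemma sub_per2 A x y : x != y -> sub_per A [set x; y] = A x x * A y y + A x y * A y x.
Proof.
move=> xy; rewrite (sub_per_row A (set21 x y)) big_setU1 ?inE //= big_set1.
by rewrite setU1K ?inE // !sub_per1 tperm1 perm1 tpermR.
Qed.

Lemma sub_per3 A x y z : x != y -> x != z -> y != z ->
  sub_per A [set x; y; z] =
    A x x * (A y y * A z z + A y z * A z y) + A x y * (A y x * A z z + A y z * A z x)
    + A x z * (A y y * A z x + A y x * A z y).
Proof.
move=> xy xz yz; have xyz : [set x; y; z] = x |: [set y; z].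
  by apply/setP => t; rewrite !inE orbA.
rewrite xyz (sub_per_row A (setU11 _ _)) big_setU1 ?inE ?negb_or ?xy //=.
rewrite big_setU1 ?inE //= big_set1 setU1K ?inE ?negb_or ?xy //.
rewrite !sub_per2 // !tperm1 !perm1 !tpermR !tpermD //; first by rewrite !addnA.
by rewrite eq_sym.
Qed.

End Permanent.

(** * Laplacians of induced subgraphs and their growth by leaves *)

Section InducedLaplacian.
Variables (T : finType) (G : rel T).
Hypotheses (Gsym : symmetric G) (Girr : irreflexive G).
Implicit Types (D S : {set T}).

Definition deg_in D x : nat := \sum_(y in D) G x y.

(** The Laplacian of the graph induced on [D], with its signs removed. *)
Definition abs_lap D x y : nat := if x == y then deg_in D x else G x y.

(** Rows and columns range over [S], while degrees are still counted in [D]. *)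
Definition lap_per D S := sub_per (abs_lap D) S.

Definition leaf D v u := [/\ v \notin D, u \in D & forall x, x \in D -> G v x = (x == u)].

Lemma setU1D1 (v u : T) S : v != u -> (v |: S) :\ u = v |: (S :\ u).
Proof. by move=> vu; apply/setP => x; rewrite !inE; case: (eqVneq x v) => [->|] //; rewrite vu. Qed.

Lemma deg_in_leaf D v u : leaf D v u -> deg_in (v |: D) v = 1.
Proof.
case=> vD uD Gv; rewrite /deg_in big_setU1 //= Girr add0n (bigD1 u) //= Gv // eqxx.
by rewrite big1 ?addn0 // => x /andP[xD /negbTE xu]; rewrite Gv // xu.
Qed.

Lemma deg_in_nonleaf D v u x : leaf D v u -> x \in D -> deg_in (v |: D) x = deg_in D x + (x == u).
Proof.
by case=> vD uD Gv xD; rewrite /deg_in big_setU1 //= Gsym Gv // addnC.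
Qed.

Lemma lap_per_in D S v u : leaf D v u -> S \subset D ->
  lap_per (v |: D) S = lap_per D S + (u \in S) * lap_per D (S :\ u).
Proof.
move=> lvu sSD; have [uS|uS] := boolP (u \in S); last first.
  rewrite addn0; apply: eq_sub_per => x y xS _; rewrite /abs_lap.
  have /negbTE xu : x != u by apply: contraNneq uS => <-.
  by rewrite (deg_in_nonleaf lvu) ?(subsetP sSD) // xu addn0.
rewrite mul1n; apply: sub_per_row_add => // [x y xS xu|y]; rewrite /abs_lap.
  by rewrite (deg_in_nonleaf lvu) ?(subsetP sSD) // (negbTE xu) addn0.
rewrite (deg_in_nonleaf lvu) ?(subsetP sSD) // eqxx [y == u]eq_sym.
by case: eqP => //; rewrite addn0.
Qed.

(** When [u] is in [S], one copy of [lap_per D (S :\ u)] comes from the raised degree of [u] and the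
    other from exchanging [v] and [u]; hence the factor 2. *)
Lemma lap_per_out D S v u : leaf D v u -> S \subset D ->
  lap_per (v |: D) (v |: S) = lap_per D S + (u \in S) * (2 * lap_per D (S :\ u)).
Proof.
move=> lvu sSD; have [vD uD Gv] := lvu.
have vS : v \notin S by apply: contra vD; apply: (subsetP sSD).
have uv : u != v by apply: contraNneq vD => <-.
have [uS|uS] := boolP (u \in S); last first.
  rewrite addn0 /lap_per (@sub_per_row1 _ _ _ v) ?setU11 //; last first.
    move=> x; rewrite !inE => /orP[->//|xS] xv.
    have /negbTE xu : x != u by apply: contraNneq uS => <-.
    by rewrite /abs_lap eq_sym (negbTE xv) Gv ?(subsetP sSD) // xu.
  rewrite {1}/abs_lap eqxx (deg_in_leaf lvu) mul1n setU1K //.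
  by have := lap_per_in lvu sSD; rewrite (negbTE uS) addn0.
rewrite mul1n /lap_per (@sub_per_leaf _ _ _ v u) ?inE ?eqxx ?uS ?orbT //; last first.
  move=> x; rewrite !inE => /orP[->//|xS] xv xu.
  rewrite /abs_lap [v == x]eq_sym (negbTE xv) [G x v]Gsym Gv ?(subsetP sSD) //.
  by rewrite (negbTE xu).
rewrite setU1K // {1 3 4}/abs_lap eqxx (negbTE uv) [v == u]eq_sym (negbTE uv).
rewrite (deg_in_leaf lvu) [G u v]Gsym Gv // eqxx !mul1n.
have := lap_per_in lvu sSD; rewrite /lap_per uS mul1n => ->.
have sD : S :\ u \subset D by apply: subset_trans sSD; apply: subsetDl.
have := lap_per_in lvu sD; rewrite /lap_per !inE eqxx addn0 => ->; lia.
Qed.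

Lemma lap_per_in_ge D S v u : leaf D v u -> S \subset D -> lap_per D S <= lap_per (v |: D) S.
Proof. by move=> lvu sSD; rewrite (lap_per_in lvu) ?leq_addr. Qed.

Lemma lap_per_out_ge D S v u : leaf D v u -> S \subset D ->
  lap_per D S <= lap_per (v |: D) (v |: S).
Proof. by move=> lvu sSD; rewrite (lap_per_out lvu) ?leq_addr. Qed.

(** Connectivity is not required: for bipartite graphs, 2-regularity already
    forces [#|D| = 4] or [6 <= #|D|], and in the second case the crude bounds
    suffice. *)
Inductive uni : {set T} -> Prop :=
| uni_regular D of (forall x, x \in D -> deg_in D x = 2) & (#|D| == 4) || (6 <= #|D|) : uni D
| uni_leaf D v u of uni D & leaf D v u : uni (v |: D).

(** * Crude lower bounds with few vertices deleted *)

Lemma lap_per_regular D S : S \subset D -> (forall x, x \in D -> deg_in D x = 2) ->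
  2 ^ #|S| <= lap_per D S.
Proof.
move=> sSD reg; move: {2}#|S| (erefl #|S|) => k; elim: k S sSD => [|k IHk] S sSD Sk.
  by rewrite (cards0_eq Sk) /lap_per sub_per0 cards0.
have /card_gt0P[x xS] : 0 < #|S| by rewrite Sk.
move: Sk; rewrite (cardsD1 x) xS => -[/(IHk _ (subset_trans (subsetDl _ _) sSD)) ge].
apply: leq_trans (sub_per_diag_ge _ xS); rewrite expnS leq_mul //.
by rewrite /abs_lap eqxx reg ?(subsetP sSD).
Qed.

(** Leaves never lower the value, so the regular base case with at least four vertices gives [2^4].
    Deleting one or two indices gives [2^3] and [2^2] below. *)
Lemma lap_per_ge16 D : uni D -> 16 <= lap_per D D.
Proof.
elim=> {D} [D reg Dc|D v u uniD IH lvu]; last first.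
  by apply: leq_trans IH _; apply: lap_per_out_ge lvu _.
apply: leq_trans (lap_per_regular (subxx D) reg).
by rewrite (@leq_exp2l 2 4) //; lia.
Qed.

Lemma lap_per_del1_ge D u : uni D -> u \in D -> 8 <= lap_per D (D :\ u).
Proof.
move=> uniD; elim: uniD u => {D} [D reg Dc|D v r uniD IH lvr] u.
  move=> uD; apply: (@leq_trans (2 ^ #|D :\ u|)); last first.
    by apply: lap_per_regular => //; apply: subsetDl.
  by rewrite (@leq_exp2l 2 3) //; move: Dc; rewrite (cardsD1 u) uD /=; lia.
have [vD rD _] := lvr.
rewrite !inE; have [-> _|uv /= uD] := eqVneq u v.
  (* Deleting the new leaf leaves all of [D], with degrees at least those in [D]. *)
  rewrite setU1K //; apply: (@leq_trans 16) => //; apply: leq_trans (lap_per_ge16 uniD) _.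
  by apply: lap_per_in_ge lvr _.
rewrite setU1D1 1?eq_sym //; apply: leq_trans (IH _ uD) _; apply: lap_per_out_ge lvr _.
exact: subsetDl.
Qed.

Lemma lap_per_del2_ge D u u' : uni D -> u \in D -> u' \in D -> u != u' ->
  4 <= lap_per D (D :\ u :\ u').
Proof.
move=> uniD; elim: uniD u u' => {D} [D reg Dc|D v r uniD IH lvr] u u'.
  move=> uD u'D uu'; apply: (@leq_trans (2 ^ #|D :\ u :\ u'|)); last first.
    by apply: lap_per_regular => //; apply/subsetP => x; rewrite !inE => /and3P[].
  rewrite (@leq_exp2l 2 2) //; move: Dc; rewrite (cardsD1 u) uD (cardsD1 u' (D :\ u)).
  by rewrite !inE u'D [u' == u]eq_sym uu' /=; lia.
have [vD rD _] := lvr.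
rewrite !inE; have [-> _|uv /= uD] := eqVneq u v.
  have [-> _|u'v /= u'D _] := eqVneq u' v; first by [].
  rewrite setU1K //; apply: (@leq_trans 8) => //; apply: leq_trans (lap_per_del1_ge uniD u'D) _.
  by apply: lap_per_in_ge lvr _; apply: subsetDl.
have [-> _ _|u'v /= u'D uu'] := eqVneq u' v.
  rewrite setU1D1 1?eq_sym // setU1K ?inE ?(negbTE vD) ?andbF //.
  apply: (@leq_trans 8) => //; apply: leq_trans (lap_per_del1_ge uniD uD) _.
  by apply: lap_per_in_ge lvr _; apply: subsetDl.
rewrite setU1D1 1?eq_sym // setU1D1 1?eq_sym //.
apply: leq_trans (IH _ _ uD u'D uu') _; apply: lap_per_out_ge lvr _.
by apply/subsetP => x; rewrite !inE => /and3P[].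
Qed.

(** The 4-cycle [c a w b], seen as the complete bipartite graph between [c, w]
    and [a, b], with every other vertex [x] pendant at [r x]. *)
Definition sun (c a w b : T) (r : T -> T) : rel T := fun x y =>
  [|| (x \in [:: c; w]) && (y \in [:: a; b]),
      (x \in [:: a; b]) && (y \in [:: c; w]),
      (x \notin [:: c; a; w; b]) && (y == r x)
    | (y \notin [:: c; a; w; b]) && (x == r y)].

Lemma sun_pendant c a w b r x y : x \notin [:: c; a; w; b] ->
  sun c a w b r x y = (y == r x) || (y \notin [:: c; a; w; b]) && (x == r y).
Proof.
move=> xC; rewrite /sun xC /=.
by move: xC; rewrite !inE !negb_or => /and4P[/negbTE -> /negbTE -> /negbTE -> /negbTE ->].
Qed.

(** * 4-cycles with pendants: adding, removing and recognising them *)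

Definition is_sun D c a w b r :=
  [/\ uniq [:: c; a; w; b], {subset [:: c; a; w; b] <= D},
      forall x, x \in D -> x \notin [:: c; a; w; b] -> r x \in [:: c; a; w; b]
    & forall x y, x \in D -> y \in D -> G x y = sun c a w b r x y].

Lemma is_sun_eq D c a w b r r' :
  (forall x, x \in D -> x \notin [:: c; a; w; b] -> r x = r' x) ->
  is_sun D c a w b r -> is_sun D c a w b r'.
Proof.
move=> eqr [Cu CD rC GE]; split=> // [x xD xC|x y xD yD]; first by rewrite -eqr ?rC.
rewrite GE // /sun; case: (boolP (x \in [:: c; a; w; b])) => xC;
case: (boolP (y \in [:: c; a; w; b])) => yC; rewrite /= ?eqr //.
Qed.

(** Reflection of the cycle through [c] and [w]; it reduces a pendant at [b] to a pendant at [a]. *)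
Lemma is_sun_flip D c a w b r : is_sun D c a w b r -> is_sun D c b w a r.
Proof.
move=> [Cu CD rC GE].
have memC x : (x \in [:: c; b; w; a]) = (x \in [:: c; a; w; b]).
  by rewrite !inE; do 4!case: (_ == _).
have memab x : (x \in [:: b; a]) = (x \in [:: a; b]) by rewrite !inE orbC.
split=> [|x|x xD|x y xD yD]; rewrite ?memC; [|exact: CD|exact: rC|].
  move: Cu; rewrite /= !inE !negb_or [b == w]eq_sym [b == a]eq_sym [w == a]eq_sym.
  by case: (c == a); case: (c == w); case: (c == b); case: (a == w); case: (a == b); case: (w == b).
by rewrite GE // /sun !memC !memab.
Qed.

Lemma is_sun_leaf D c a w b r v u : is_sun D c a w b r -> leaf D v u -> u = r v ->
  u \in [:: c; a; w; b] -> is_sun (v |: D) c a w b r.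
Proof.
move=> [Cu CD rC GE] [vD uD Gv] uE uC.
have vC : v \notin [:: c; a; w; b] by apply: contra vD; apply: CD.
have sunS x y : sun c a w b r x y = sun c a w b r y x.
  rewrite /sun; do 2!case: (_ \in [:: c; w]); do 2!case: (_ \in [:: a; b]);
  by do 2!case: (_ \in [:: c; a; w; b]); rewrite //= ?orbF // orbC.
have sunvy y : y \in D -> sun c a w b r v y = (y == u).
  move=> yD; rewrite sun_pendant // -uE; case: (boolP (y \in _)) => yC; rewrite ?orbF //=.
  have /negbTE -> : v != r y; last by rewrite orbF.
  by apply: contraNneq vC => ->; rewrite rC.
split=> // [x /CD xD|x|x y]; first by rewrite inE xD orbT.
  by move=> /setU1P[-> _|]; [rewrite -uE | apply: rC].
move=> /setU1P[->|xD] /setU1P[->|yD].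
- rewrite Girr sun_pendant // vC /= -uE orbb; apply/esym/negbTE.
  by apply: contraNneq vC => ->.
- by rewrite Gv // sunvy.
- by rewrite Gsym sunS Gv // sunvy.
- exact: GE.
Qed.

Lemma is_sun_del D c a w b r v : is_sun (v |: D) c a w b r -> v \notin D ->
  v \notin [:: c; a; w; b] -> leaf D v (r v) /\ is_sun D c a w b r.
Proof.
move=> [Cu CD rC GE] vD vC.
have CD' x : x \in [:: c; a; w; b] -> x \in D.
  by move=> xC; have /setU1P := CD _ xC; move=> [xv|//]; rewrite -xv xC in vC.
have rvC : r v \in [:: c; a; w; b] by rewrite rC // setU11.
split; last first.
  split=> // [x xD|x y xD yD]; first by apply: rC; rewrite inE xD orbT.
  by rewrite GE // inE ?xD ?yD orbT.
split=> // [|x xD]; first exact: CD'.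
have xv : x != v by apply: contraNneq vD => <-.
rewrite GE ?setU11 ?inE ?xD ?orbT // /sun.
rewrite -/(sun c a w b r v x) sun_pendant //.
case: (boolP (x \in [:: c; a; w; b])) => xC /=; rewrite ?orbF //.
have /negbTE -> : v != r x.
  by apply: contraNneq vC => ->; apply: rC => //; rewrite inE xD orbT.
by rewrite orbF.
Qed.

Lemma uniq_neq (c a w b : T) : uniq [:: c; a; w; b] ->
  [/\ c != a, c != w, c != b, a != w & a != b] /\ w != b.
Proof.
rewrite /= !inE !negb_or => /and4P[/and3P[-> -> ->] /andP[-> ->] -> _].
by [].
Qed.

Lemma deg_inE D x : deg_in D x = #|[set y in D | G x y]|.
Proof.
by rewrite /deg_in -sum1dep_card big_mkcondr; apply: eq_bigr => y _; case: (G x y).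
Qed.

(** Let [a], [b] be the neighbours of [c] and [w] the fourth vertex. As [w] is not adjacent to [c],
    its degree forces edges to [a] and [b], which exhausts their degrees too. No vertex lies off the
    cycle, so the constant map [c] serves as [r]. *)
Lemma is_sun_regular4 D c : (forall x, x \in D -> deg_in D x = 2) -> #|D| = 4 -> c \in D ->
  exists a w b, is_sun D c a w b (fun=> c).
Proof.
move=> reg D4 cD; have /eqP := reg c cD; rewrite deg_inE => /cards2P[a [b [ab NE]]].
have Nin x : (x \in D) && G c x = (x == a) || (x == b).
  by have /setP/(_ x) := NE; rewrite !inE.
have /andP[aD Gca] : (a \in D) && G c a by rewrite Nin eqxx.
have /andP[bD Gcb] : (b \in D) && G c b by rewrite Nin eqxx orbT.
have ca : c != a by apply: contraTneq Gca => <-; rewrite Girr.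
have cb : c != b by apply: contraTneq Gcb => <-; rewrite Girr.
have /cards1P[w wE] : #|D :\ c :\ a :\ b| == 1.
  move: D4; rewrite (cardsD1 c) cD (cardsD1 a) (cardsD1 b (_ :\ a)) !inE aD bD.
  by rewrite [a == c]eq_sym [b == c]eq_sym [b == a]eq_sym ca cb ab /=; lia.
have : w \in D :\ c :\ a :\ b by rewrite wE set11.
rewrite !inE => /and4P[wb wa wc wD].
have N : ((((c == a) = false) * ((c == w) = false) * ((c == b) = false) * ((a == w) = false)
   * ((a == b) = false) * ((w == b) = false)) *
 (((a == c) = false) * ((w == c) = false) * ((b == c) = false) * ((w == a) = false)
   * ((b == a) = false) * ((b == w) = false)))%type.
  by do !split; apply: negbTE; rewrite // eq_sym.
have DE : D = c |: (a |: (w |: [set b])).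
  apply/setP => x; have /setP/(_ x) := wE; rewrite !inE.
  case: (eqVneq x c) => [->|_] //=; case: (eqVneq x a) => [->|_] //=.
  by case: (eqVneq x b) => [->|_] /=; rewrite ?orbT ?orbF.
have degE x : x \in D -> G x c + (G x a + (G x w + G x b)) = 2.
  by move=> /reg <-; rewrite /deg_in DE !big_setU1 ?inE ?N //= big_set1.
have Gcw : G c w = false.
  by apply: negbTE; have := Nin w; rewrite !N wD /= => ->.
move: (degE w wD) (degE a aD) (degE b bD); rewrite !Girr ![G _ c]Gsym Gca Gcb Gcw.
rewrite [G b a]Gsym [G b w]Gsym [G a w]Gsym.
case Gwa: (G w a) => //; case Gwb: (G w b) => // _.
case Gab: (G a b) => // _ _.
exists a, w, b; split => [||x _ _|x y].
- by rewrite /= !inE !N.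
- by move=> x; rewrite DE !inE.
- by rewrite inE eqxx.
rewrite {1 2}DE !inE /sun => /or4P[] /eqP-> /or4P[] /eqP->; rewrite !inE ?eqxx ?N /= ?Girr //.
all: by rewrite ?Gca ?Gcb ?Gcw ?Gwa ?Gwb ?Gab // Gsym ?Gca ?Gcb ?Gcw ?Gwa ?Gwb ?Gab.
Qed.

(** * Exact values for the three extremal families *)

Lemma is_sun4 D c a w b r : is_sun D c a w b r -> #|D| = 4 -> D = [set c; a; w; b].
Proof.
move=> [Cu CD _ _] D4; apply/esym/eqP; rewrite eqEcard D4; apply/andP; split.
  by apply/subsetP => x xC; apply: CD; move: xC; rewrite !inE !orbA.
have <- : #|[:: c; a; w; b]| = 4 by exact: (card_uniqP Cu).
by apply/subset_leq_card/subsetP => x; rewrite !inE !orbA.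
Qed.

(** With [n = #|D|] the values are [24n-60], [12], [8n-20] and twice [10n-28], written without
    truncated subtraction. The constants [4], [5], [5] make the list closed under adding a pendant
    at [c]. *)
Definition sun_values D c a w b :=
  [/\ lap_per D D + 60 = 24 * #|D|, lap_per D (D :\ c) = 12,
      lap_per D (D :\ w) + 20 = 8 * #|D|,
      lap_per D (D :\ a) + 28 = 10 * #|D| & lap_per D (D :\ b) + 28 = 10 * #|D|]
  /\ [/\ lap_per D (D :\ c :\ w) = 4, lap_per D (D :\ c :\ a) = 5 &
      lap_per D (D :\ c :\ b) = 5].

Lemma sun_values4 D c a w b r : is_sun D c a w b r -> #|D| = 4 -> sun_values D c a w b.
Proof.
move=> sD D4; have DE := is_sun4 sD D4; have [Cu _ _ GE] := sD.
have [[ca cw cb aw ab] wb] := uniq_neq Cu.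
have DE' : D = c |: (a |: (w |: [set b])) by rewrite DE !setUA.
have cD : c \in D by rewrite DE' !inE eqxx.
have aD : a \in D by rewrite DE' !inE eqxx ?orbT.
have wD : w \in D by rewrite DE' !inE eqxx ?orbT.
have bD : b \in D by rewrite DE' !inE eqxx ?orbT.
have N : ((((c == a) = false) * ((c == w) = false) * ((c == b) = false) * ((a == w) = false)
   * ((a == b) = false) * ((w == b) = false)) *
 (((a == c) = false) * ((w == c) = false) * ((b == c) = false) * ((w == a) = false)
   * ((b == a) = false) * ((b == w) = false)))%type.
  rewrite [w == c]eq_sym [b == a]eq_sym [b == c]eq_sym [a == c]eq_sym [b == w]eq_sym [w == a]eq_sym.
  by do !split; apply: negbTE.
have E : (((G c c = false) * (G a a = false) * (G w w = false) * (G b b = false)) *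
  ((G c a = true) * (G a c = true) * (G a w = true) * (G w a = true)) *
  ((G w b = true) * (G b w = true) * (G b c = true) * (G c b = true)) *
  ((G c w = false) * (G w c = false) * (G a b = false) * (G b a = false)))%type.
  by rewrite !Girr !GE // /sun !inE !eqxx !N.
have degE x : deg_in D x = G x c + (G x a + (G x w + G x b)).
  by rewrite /deg_in DE' !big_setU1 ?inE ?N //= big_set1.
have Dc : D :\ c = [set a; w; b].
  by rewrite DE' setU1K ?inE ?N // setUA.
have Da : D :\ a = [set c; w; b].
  rewrite DE; apply/setP => x; rewrite !inE; case: (eqVneq x a) => [->|] //=; rewrite ?N //.
  by rewrite orbF.
have Dw : D :\ w = [set c; a; b].
  rewrite DE; apply/setP => x; rewrite !inE; case: (eqVneq x w) => [->|] //=; rewrite ?N //.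
  by rewrite orbF.
have Db : D :\ b = [set c; a; w].
  rewrite DE; apply/setP => x; rewrite !inE; case: (eqVneq x b) => [->|] //=; rewrite ?N //.
  by rewrite orbF.
have Dcw : D :\ c :\ w = [set a; b].
  rewrite Dc; apply/setP => x; rewrite !inE; case: (eqVneq x w) => [->|] //=; rewrite ?N //.
  by rewrite orbF.
have Dca : D :\ c :\ a = [set w; b].
  rewrite Dc; apply/setP => x; rewrite !inE; case: (eqVneq x a) => [->|] //=; rewrite ?N //.
have Dcb : D :\ c :\ b = [set a; w].
  rewrite Dc; apply/setP => x; rewrite !inE; case: (eqVneq x b) => [->|] //=; rewrite ?N //.
  by rewrite orbF.
rewrite /sun_values Dc Da Dw Db -Dc Dcw Dca Dcb Dc D4 /lap_per.
(* Only the full permanent has order four; row [c] reduces it to order three. *)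
rewrite !sub_per3 ?sub_per2 // ?N // (sub_per_row _ cD) {1}DE' !big_setU1 ?inE ?N //= big_set1.
rewrite Dc !sub_per3 ?N //= !tperm1 !perm1 !tpermR !tpermD ?N //.
by rewrite /abs_lap !eqxx !N !degE !E.
Qed.

Lemma lap_per_leaf D v u : leaf D v u ->
  lap_per (v |: D) (v |: D) = lap_per D D + 2 * lap_per D (D :\ u).
Proof. by move=> lvu; rewrite (lap_per_out lvu) //; have [_ -> _] := lvu; rewrite mul1n. Qed.

Lemma lap_per_leaf_del D v u : leaf D v u ->
  lap_per (v |: D) ((v |: D) :\ v) = lap_per D D + lap_per D (D :\ u).
Proof.
move=> lvu; have [vD uD _] := lvu.
by rewrite setU1K // (lap_per_in lvu) // uD mul1n.
Qed.

(** Once [u] is deleted, the row of the leaf retains only its diagonal entry 1. *)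
Lemma lap_per_leaf_root D v u : leaf D v u ->
  lap_per (v |: D) ((v |: D) :\ u) = lap_per D (D :\ u).
Proof.
move=> lvu; have [vD uD _] := lvu; have vu : v != u by apply: contraNneq vD => ->.
by rewrite setU1D1 // (lap_per_out lvu) ?subsetDl // !inE eqxx addn0.
Qed.

Lemma lap_per_leaf_root2 D v u x : leaf D v u -> x \in D ->
  lap_per (v |: D) ((v |: D) :\ u :\ x) = lap_per D (D :\ u :\ x).
Proof.
move=> lvu xD; have [vD uD _] := lvu; have vu : v != u by apply: contraNneq vD => ->.
have vx : v != x by apply: contraNneq vD => ->.
rewrite !setU1D1 // (lap_per_out lvu) ?inE ?eqxx ?andbF ?addn0 //.
by apply/subsetP => y; rewrite !inE => /and3P[].
Qed.

Lemma lap_per_leaf1 D v u x : leaf D v u -> x \in D -> x != u ->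
  lap_per (v |: D) ((v |: D) :\ x) = lap_per D (D :\ x) + 2 * lap_per D (D :\ u :\ x).
Proof.
move=> lvu xD xu; have [vD uD _] := lvu.
have vx : v != x by apply: contraNneq vD => ->.
rewrite setU1D1 // (lap_per_out lvu) ?subsetDl // !inE uD eq_sym xu mul1n.
by congr (_ + 2 * lap_per _ _); rewrite !setDDl setUC.
Qed.

Lemma sun_card D c a w b r : is_sun D c a w b r -> 4 <= #|D|.
Proof.
move=> [Cu CD _ _]; have <- : #|[:: c; a; w; b]| = 4 by exact: (card_uniqP Cu).
exact/subset_leq_card/subsetP.
Qed.

Lemma sun_cycle_mem D c a w b r : is_sun D c a w b r ->
  [/\ c \in D, a \in D, w \in D & b \in D].
Proof. by move=> [_ CD _ _]; split; apply: CD; rewrite !inE eqxx ?orbT. Qed.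

Lemma star_leaf D c a w b v : is_sun D c a w b (fun=> c) -> v \in D ->
  v \notin [:: c; a; w; b] ->
  leaf (D :\ v) v c /\ is_sun (D :\ v) c a w b (fun=> c).
Proof. by move=> sD vD vC; apply: is_sun_del; rewrite ?setD1K // !inE eqxx. Qed.

(** Induction on the pendants at [c]: the slopes [24], [8], [10] are twice the constants [12], [4],
    [5], and the minors without [c] do not change. *)
Lemma star_values D c a w b : is_sun D c a w b (fun=> c) -> sun_values D c a w b.
Proof.
have [k] := ubnP #|D|; elim: k D => // k IHk D; rewrite ltnS => Dk sD.
have := sun_card sD; rewrite leq_eqVlt => /predU1P[D4|D5].
  exact: sun_values4 sD (esym D4).
have /subsetPn[v vD vC] : ~~ (D \subset [:: c; a; w; b]).
  apply: contraTN D5 => /subset_leq_card; rewrite -leqNgt => /leq_trans; apply.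
  exact: card_size.
have [lv sE] := star_leaf sD vD vC.
have Dv : #|D| = (#|D :\ v|).+1 by rewrite (cardsD1 v) vD.
have Ek : #|D :\ v| < k by rewrite -Dv.
have vE := IHk _ Ek sE; move: vE lv sE (setD1K vD); move: (D :\ v) => E vE lv sE <-.
have [[Cu _ _ _] [cE aE wE bE]] := (sE, sun_cycle_mem sE).
have [[ca cw cb _ _] _] := uniq_neq Cu.
have [[Phi xc xw xa xb] [ycw yca ycb]] := vE; rewrite /sun_values.
rewrite (lap_per_leaf lv) (lap_per_leaf_root lv) !(lap_per_leaf1 lv) // 1?eq_sym //.
rewrite !(lap_per_leaf_root2 lv) // ycw yca ycb xc cardsU1; have [-> _ _] := lv.
by clear -Phi xw xa xb; do !split; lia.
Qed.

Lemma star_pendant D c a w b x : is_sun D c a w b (fun=> c) -> x \in D ->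
  x \notin [:: c; a; w; b] -> lap_per D (D :\ x) + 72 = 24 * #|D|.
Proof.
move=> sD xD xC; have [lx sE] := star_leaf sD xD xC.
have [[Phi xc _ _ _] _] := star_values sE.
have := lap_per_leaf_del lx; rewrite setD1K // => ->.
by rewrite (cardsD1 x D) xD; lia.
Qed.

Lemma star_del_pendant D c a w b x : is_sun D c a w b (fun=> c) -> x \in D ->
  x \notin [:: c; a; w; b] -> lap_per D (D :\ c :\ x) = 12.
Proof.
move=> sD xD xC; have [lx sE] := star_leaf sD xD xC.
have [[_ <- _ _ _] _] := star_values sE.
have := lap_per_in lx (subsetDl (D :\ x) [set c]).
by rewrite setD1K // !inE eqxx addn0 !setDDl setUC.
Qed.

(** The opposite vertex [w] attains the minimum: with at least four vertices, [10n-28] and [24n-72]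
    both dominate [8n-20]. *)
Lemma star_noncenter_ge D c a w b x : is_sun D c a w b (fun=> c) -> x \in D -> x != c ->
  8 * #|D| <= lap_per D (D :\ x) + 20.
Proof.
move=> sD xD xc; have [[_ _ xw xa xb] _] := star_values sD; have D4 := sun_card sD.
have [xC|xC] := boolP (x \in [:: c; a; w; b]).
  by move: xC; rewrite !inE (negbTE xc) /= => /or3P[] /eqP->; lia.
have := star_pendant sD xD xC; have := sun_card (star_leaf sD xD xC).2.
by rewrite (cardsD1 x D) xD; lia.
Qed.

Definition is_star D c := exists a w b, is_sun D c a w b (fun=> c).

Definition sun_with D c a w b p q := [/\ p \in D, p \notin [:: c; a; w; b],
  q \in [:: c; a; w; b] & is_sun D c a w b (fun x => if x == p then q else c)].

(** On [n] vertices, [is_star], [is_opp_sun] and [is_adj_sun] describe [B(2, n-2)],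
    [C_4(1^1 0, 1^0 0, 1^(n-5) 0, 1^0 0)] and [B(3, n-3)], with [c] the vertex carrying
    the unbounded number of pendants. *)
Definition is_opp_sun D c := exists a w b p, sun_with D c a w b p w.

Definition is_adj_sun D c := exists a w b p, sun_with D c a w b p a.

Lemma sun_withP D c a w b p q : sun_with D c a w b p q ->
  [/\ p \in D, leaf (D :\ p) p q & is_sun (D :\ p) c a w b (fun=> c)].
Proof.
move=> [pD pC qC sD].
have [] := @is_sun_del (D :\ p) c a w b (fun x => if x == p then q else c) p;
  rewrite ?setD1K ?eqxx // ?inE ?eqxx // => lp sE.
by split=> //; apply: is_sun_eq sE => x; rewrite !inE => /andP[/negbTE ->].
Qed.

Lemma star_with D c a w b v q : is_sun D c a w b (fun=> c) -> q \in [:: c; a; w; b] ->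
  leaf D v q -> sun_with (v |: D) c a w b v q.
Proof.
move=> sD qC lv; have [vD _ _] := lv; split=> //; first exact: setU11.
  by apply: contra vD; have [_ CD _ _] := sD; apply: CD.
apply: is_sun_leaf lv _ _; rewrite ?eqxx //.
by apply: is_sun_eq sD => x xD _; case: eqP => // xv; rewrite -xv xD in vD.
Qed.

Lemma sun_with_leaf D c a w b p q v : sun_with D c a w b p q -> leaf D v c ->
  sun_with (v |: D) c a w b p q.
Proof.
move=> [pD pC qC sD] lv; have [vD _ _] := lv; split=> //; first by rewrite inE pD orbT.
apply: is_sun_leaf sD lv _ _; last by rewrite inE eqxx.
by case: eqP => // vp; rewrite vp pD in vD.
Qed.

Lemma star_lap D c : is_star D c ->
  lap_per D D + 60 = 24 * #|D| /\ lap_per D (D :\ c) = 12.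
Proof. by move=> [a [w [b /star_values[[-> ->]]]]]. Qed.

(** Removing [p] leaves a star on [m] vertices, so the values are [24m-60 + 2(8m-20) = 40(m+1)-140]
    and [12 + 2*4]. *)
Lemma opp_sun_lap D c : is_opp_sun D c ->
  [/\ 5 <= #|D|, lap_per D D + 140 = 40 * #|D| & lap_per D (D :\ c) = 20].
Proof.
move=> [a [w [b [p /sun_withP[pD lp sE]]]]]; have := sun_card sE.
have [[Phi xc xw _ _] [ycw _ _]] := star_values sE.
have [[Cu _ _ _] [cE _ wE _]] := (sE, sun_cycle_mem sE).
have [[_ cw _ _ _] _] := uniq_neq Cu.
have := lap_per_leaf1 lp cE cw; have := lap_per_leaf lp.
rewrite setD1K // (cardsD1 p D) pD => -> ->.
have <- : D :\ p :\ c :\ w = D :\ p :\ w :\ c by rewrite !setDDl [[set c] :|: _]setUC.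
by split; lia.
Qed.

(** Here [p] hangs at [a], giving [24m-60 + 2(10m-28) = 44(m+1)-160] and [12 + 2*5]. *)
Lemma adj_sun_lap D c : is_adj_sun D c ->
  [/\ 5 <= #|D|, lap_per D D + 160 = 44 * #|D| & lap_per D (D :\ c) = 22].
Proof.
move=> [a [w [b [p /sun_withP[pD lp sE]]]]]; have := sun_card sE.
have [[Phi xc _ xa _] [_ yca _]] := star_values sE.
have [[Cu _ _ _] [cE aE _ _]] := (sE, sun_cycle_mem sE).
have [[ca _ _ _ _] _] := uniq_neq Cu.
have := lap_per_leaf1 lp cE ca; have := lap_per_leaf lp.
rewrite setD1K // (cardsD1 p D) pD => -> ->.
have <- : D :\ p :\ c :\ a = D :\ p :\ a :\ c by rewrite !setDDl [[set c] :|: _]setUC.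
by split; lia.
Qed.

(** * Classification by the minor at the attachment vertex *)

Lemma star_grow D c v u : is_star D c -> leaf D v u ->
  [\/ u = c /\ is_star (v |: D) c, is_opp_sun (v |: D) c, is_adj_sun (v |: D) c |
    exists a w b, is_sun D c a w b (fun=> c) /\ u \notin [:: c; a; w; b]].
Proof.
move=> [a [w [b sD]]] lv; have [uC|uC] := boolP (u \in [:: c; a; w; b]); last first.
  by constructor 4; exists a, w, b.
have := uC; rewrite !inE => /or4P[] /eqP uE; move: lv uC; rewrite uE => lv uC.
- by constructor 1; split=> //; exists a, w, b; apply: is_sun_leaf sD lv _ _.
- by constructor 3; exists a, w, b, v; apply: star_with.
- by constructor 2; exists a, w, b, v; apply: star_with.
(* A leaf at [b]: the reflected cycle presents it as a leaf at the first neighbour. *)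
- constructor 3; exists b, w, a, v; apply: star_with => //; first exact: is_sun_flip.
  by rewrite !inE eqxx orbT.
Qed.

(** A leaf at [u] itself changes neither the minor nor the shape. A leaf at another vertex adds at
    least [2*4], lifting a minor of 20 or more to 28; only a star centred at [u], with minor 12,
    needs a closer look. *)
Lemma root_dichotomy D u : uni D -> u \in D ->
  [\/ is_star D u, is_opp_sun D u, is_adj_sun D u | 28 <= lap_per D (D :\ u)].
Proof.
move=> uniD; elim: uniD u => {D} [D reg Dc|D v r uniD IH lv] u.
  move=> uD; case/orP: Dc => [/eqP D4|D6].
    by constructor 1; apply: is_sun_regular4.
  constructor 4; apply: (@leq_trans (2 ^ 5)) => //.
  apply: leq_trans (lap_per_regular (subsetDl _ _) reg).
  by rewrite leq_exp2l //; move: D6; rewrite (cardsD1 u) uD.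
have [vD rD _] := lv.
rewrite !inE; have [-> _|uv /= uD] := eqVneq u v.
  (* Here [u] is the new leaf: the minor is the full permanent of [D], at least 16, plus the minor
     at [r], at least 12 by induction. *)
  constructor 4; rewrite (lap_per_leaf_del lv).
  have Phi := lap_per_ge16 uniD.
  case: (IH r rD) => [/star_lap[_]|/opp_sun_lap[_ _]|/adj_sun_lap[_ _]|]; lia.
have [ur|ur] := eqVneq u r; first rewrite -ur in lv.
  rewrite (lap_per_leaf_root lv).
  case: (IH u uD) => [[a [w [b sD]]]|[a [w [b [p sD]]]]|[a [w [b [p sD]]]]|]; last by constructor 4.
  - by constructor 1; exists a, w, b; apply: is_sun_leaf sD lv _ _; rewrite ?inE ?eqxx.
  - by constructor 2; exists a, w, b, p; apply: sun_with_leaf.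
  - by constructor 3; exists a, w, b, p; apply: sun_with_leaf.
rewrite (lap_per_leaf1 lv) //.
have y4 := lap_per_del2_ge uniD rD uD.
rewrite eq_sym in ur.
case: (IH u uD) => [sD|/opp_sun_lap[_ _ ->]|/adj_sun_lap[_ _ ->]|x28]; last 3 first.
- by constructor 4; have := y4 ur; lia.
- by constructor 4; have := y4 ur; lia.
- by constructor 4; have := y4 ur; lia.
case: (star_grow sD lv) => [[ru]|?|?|[a [w [b [{}sD rC]]]]].
- by rewrite ru eqxx in ur.
- by constructor 2.
- by constructor 3.
have [_ u12] := star_lap (ex_intro _ a (ex_intro _ w (ex_intro _ b sD))).
have Dru : D :\ r :\ u = D :\ u :\ r by rewrite !setDDl setUC.
(* With [r] a pendant of the star, the minor is [12 + 2*12 = 36]. *)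
by constructor 4; rewrite u12 Dru (star_del_pendant sD).
Qed.

(** * Regular graphs and the three-way bound *)

Lemma lap_per_regular_row D S v : S \subset D -> (forall x, x \in D -> deg_in D x = 2) ->
  v \in S -> 2 * lap_per D (S :\ v) + deg_in (S :\ v) v * 2 ^ (#|S| - 2) <= lap_per D S.
Proof.
move=> sSD reg vS; apply: leq_trans (sub_per_ge _ vS).
have -> : abs_lap D v v = 2 by rewrite /abs_lap eqxx reg ?(subsetP sSD).
rewrite leq_add2l /deg_in big_distrl /=.
apply: leq_sum => u; rewrite !inE => /andP[uv uS].
rewrite /abs_lap [v == u]eq_sym (negbTE uv) [G u v]Gsym mulnb andbb leq_mul2l.
apply/orP; right; have -> : #|S| - 2 = #|S :\ v :\ u|.
  by rewrite (cardsD1 v) vS (cardsD1 u (S :\ v)) !inE uv uS; lia.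
apply: lap_per_regular => //; apply: subset_trans sSD.
by apply/subsetP => x; rewrite !inE => /and3P[].
Qed.

(** The diagonal alone gives [2^n], too small at six vertices. Expanding at [v] and then at another
    vertex [x], with fixed points and transpositions, yields [2(2*2^(n-2) + 2^(n-3)) + 2*2^(n-2) =
    7*2^(n-2)]. *)
Lemma lap_per_regular_ge D : (forall x, x \in D -> deg_in D x = 2) -> 2 < #|D| ->
  7 * 2 ^ (#|D| - 2) <= lap_per D D.
Proof.
move=> reg D3; have /card_gt0P[v vD] : 0 < #|D| by lia.
have Dv : #|D :\ v| = #|D| - 1 by rewrite (cardsD1 v D) vD; lia.
have /card_gt0P[x xDv] : 0 < #|D :\ v| by rewrite Dv; lia.
have xD : x \in D by move: xDv; rewrite !inE => /andP[].
have degD1 S y z : y \in S -> deg_in S z = G z y + deg_in (S :\ y) z.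
  by move=> yS; rewrite /deg_in (big_setD1 y).
have dv := degD1 D v v vD; have dx := degD1 D v x vD; have dxx := degD1 (D :\ v) x x xDv.
rewrite Girr reg // add0n in dv; rewrite reg // in dx; rewrite Girr add0n in dxx.
(* Of its two neighbours, [x] loses at most [v]. *)
have dx1 : 0 < deg_in (D :\ v :\ x) x by rewrite -dxx; move: dx; case: (G x v); lia.
have L1 := lap_per_regular_row (subxx D) reg vD.
have L2 := lap_per_regular_row (subsetDl D [set v]) reg xDv.
have sDvx : D :\ v :\ x \subset D by apply/subsetP => y; rewrite !inE => /and3P[].
have L3 := lap_per_regular sDvx reg.
have Dvx : #|D :\ v :\ x| = #|D| - 2.
  by move: Dv; rewrite (cardsD1 x (D :\ v)) xDv; lia.
rewrite -dv in L1; rewrite Dv in L2; rewrite Dvx in L3.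
have E : 2 ^ (#|D| - 2) = 2 * 2 ^ (#|D| - 1 - 2) by rewrite -expnS; congr (2 ^ _); lia.
have : 2 ^ (#|D| - 1 - 2) <= deg_in (D :\ v :\ x) x * 2 ^ (#|D| - 1 - 2) by rewrite leq_pmull.
by move: L1 L2 L3; rewrite E; clear; lia.
Qed.

(** The constant 159 makes the last alternative strict: the value exceeds [44n-160]. A leaf at a
    vertex with minor below 28 stays within its family; any other adds at least 56, more than the
    slope 44. *)
Lemma uni_lap_trichotomy D : uni D ->
  (exists c, is_star D c) \/
  6 <= #|D| /\ [\/ exists c, is_opp_sun D c, exists c, is_adj_sun D c
                 | 44 * #|D| <= lap_per D D + 159].
Proof.
elim=> {D} [D reg Dc|D v r uniD IH lv].
  case/orP: Dc => [/eqP D4|D6].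
    have /card_gt0P[c cD] : 0 < #|D| by rewrite D4.
    by left; exists c; apply: is_sun_regular4.
  right; split=> //; constructor 3; have := lap_per_regular_ge reg (leq_trans (isT : 2 < 6) D6).
  (* Reduces the exponential bound to the linear [112(n-5)], enough from [n = 6] on. *)
  have := ltn_expl (#|D| - 6) (isT : 1 < 2).
  have -> : 2 ^ (#|D| - 2) = 2 ^ (#|D| - 6) * 2 ^ 4 by rewrite -expnD; congr (2 ^ _); lia.
  by move: D6; clear; lia.
have [vD rD _] := lv.
have cD' : #|v |: D| = #|D|.+1 by rewrite cardsU1 vD.
case: (root_dichotomy uniD rD) => [[a [w [b sD]]]|oD|aD|x28].
- by left; exists r, a, w, b; apply: is_sun_leaf sD lv _ _; rewrite ?inE ?eqxx.
- right; have [D5 _ _] := opp_sun_lap oD; split; first by rewrite cD'.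
  have [a [w [b [p sD]]]] := oD.
  by constructor 1; exists r, a, w, b, p; apply: sun_with_leaf.
- right; have [D5 _ _] := adj_sun_lap aD; split; first by rewrite cD'.
  have [a [w [b [p sD]]]] := aD.
  by constructor 2; exists r, a, w, b, p; apply: sun_with_leaf.
have Phi := lap_per_leaf lv.
case: IH => [[c sD]|[D6 [[c oD]|[c aD]|big]]].
- have [PhiD _] := star_lap sD.
  case: (star_grow sD lv) => [[_ ?]|oD|aD|[a [w [b [{}sD rC]]]]]; first by left; exists c.
  (* The size bound comes from the minor: with [m = #|D|], [24m-60 + 56 <= 40m-100] forces [m >= 6].
     The adjacent case is similar. *)
  + right; have [D5 PhiE _] := opp_sun_lap oD; split; last by constructor 1; exists c.
    by move: x28 Phi PhiE PhiD cD' D5; clear; lia.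
  + right; have [D5 PhiE _] := adj_sun_lap aD; split; last by constructor 2; exists c.
    by move: x28 Phi PhiE PhiD cD' D5; clear; lia.
  have xr := star_pendant sD rD rC; have := sun_card (star_leaf sD rD rC).2.
  move=> E4; right; have D5 : 4 < #|D| by rewrite (cardsD1 r) rD.
  split; first by rewrite cD'.
  by constructor 3; move: xr Phi PhiD cD' D5; clear; lia.
- right; split; first by rewrite cD'; apply: leqW.
  have [_ PhiD _] := opp_sun_lap oD; have [a [w [b [p sD]]]] := oD.
  have [rc|rc] := eqVneq r c.
    by constructor 1; exists c, a, w, b, p; rewrite rc in lv; apply: sun_with_leaf.
  constructor 3; have [pD lp sE] := sun_withP sD.
  have Dp : #|D| = #|D :\ p|.+1 by rewrite (cardsD1 p) pD.
  (* The bound 28 on the minor suffices up to seven vertices of [D], and the linear bound [8m-28]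
     from seven on. *)
  suff xr : 8 * #|D| <= lap_per D (D :\ r) + 28.
    by move: xr x28 Phi PhiD cD' D6; clear; lia.
  have [[PhiE _ xw _ _] _] := star_values sE.
  have [rp|rp] := eqVneq r p.
    have := lap_per_leaf_del lp; rewrite setD1K // rp => ->.
    by move: PhiE xw Dp D6; clear; lia.
  have rE : r \in D :\ p by rewrite !inE rp.
  (* The star [D :\ p] has [m-1] vertices, and [8(m-1)-20 = 8m-28]. *)
  have := star_noncenter_ge sE rE rc.
  have := lap_per_out_ge lp (subsetDl (D :\ p) [set r]).
  rewrite setD1K // -setU1D1 1?eq_sym // setD1K //.
  by rewrite Dp; clear; lia.
- right; split; first by rewrite cD'; apply: leqW.
  have [_ PhiD _] := adj_sun_lap aD.
  by constructor 3; move: x28 Phi PhiD cD'; clear; lia.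
- right; split; first by rewrite cD'; apply: leqW.
  by constructor 3; move: x28 Phi big cD'; clear; lia.
Qed.

End InducedLaplacian.

(** * From bipartite unicyclic graphs to the inductive predicate [uni] *)

Section UnicyclicGraphs.
Variables (T : finType) (G : rel T).
Hypotheses (Gsym : symmetric G) (Girr : irreflexive G).
Implicit Types (D X : {set T}).

(** Stated with cuts rather than paths, so that deleting a leaf needs no path surgery. *)
Definition cut_connected D := forall X, X \subset D -> X != set0 -> X != D ->
  exists x y, [/\ x \in X, y \in D, y \notin X & G x y].

(** The leaf is put on the same side of the cut as [u]; then no crossing edge can use it. *)
Lemma cut_connected_leaf D v u : leaf G D v u -> cut_connected (v |: D) -> cut_connected D.
Proof.
move=> [vD uD Gv] conn X sXD X0 XD.
have vX : v \notin X by apply: contra vD; apply: (subsetP sXD).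
have [uX|uX] := boolP (u \in X).
  have [||| x [y [xX yD yX Gxy]]] := conn (v |: X).
  - by apply: setUS.
  - by apply/set0Pn; exists v; apply: setU11.
  - by apply: contra XD => /eqP E; rewrite -(setU1K vX) -(setU1K vD) E.
  move: yD yX xX; rewrite !inE negb_or => /predU1P[->|yD]; first by rewrite eqxx.
  move=> /andP[yv yX] /predU1P[xv|xX]; last by exists x, y.
  by move: Gxy; rewrite xv Gv // => /eqP yu; rewrite yu uX in yX.
have [||| x [y [xX yD yX Gxy]]] := conn X => //.
- by apply: subset_trans sXD _; apply: subsetUr.
- by apply: contraNneq vX => ->; apply: setU11.
move: yD; rewrite !inE => /predU1P[yv|yD]; last by exists x, y.
move: Gxy; rewrite yv Gsym Gv ?(subsetP sXD) // => /eqP xu.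
by rewrite xu (negbTE uX) in xX.
Qed.

(** Counting edges from either colour class shows that the classes have equal size. *)
Lemma regular_bipartite_even D (c : T -> bool) : (forall x y, G x y -> c x != c y) ->
  (forall x, x \in D -> deg_in G D x = 2) -> ~~ odd #|D|.
Proof.
move=> bip reg.
have E : \sum_(x in D | c x) 2 = \sum_(x in D | ~~ c x) 2.
  transitivity (\sum_(x in D | c x) \sum_(y in D | ~~ c y) G x y).
    apply: eq_bigr => x /andP[xD cx]; rewrite -(reg x xD) /deg_in (bigID c) /=.
    rewrite big1 ?add0n // => y /andP[_ cy]; apply/eqP; rewrite eqb0.
    by apply: contraTN cy => /bip; rewrite cx; case: (c y).
  rewrite exchange_big /=; apply: eq_bigr => x /andP[xD cx].
  rewrite -(reg x xD) /deg_in [RHS](bigID c) /= [X in _ = _ + X]big1 ?addn0.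
    by apply: eq_bigr => y _; rewrite Gsym.
  move=> y /andP[_ cy]; apply/eqP; rewrite eqb0.
  by apply: contraTN cx => /bip; move: cy; case: (c y); case: (c x).
have : \sum_(x in D) 2 = \sum_(x in D | c x) 2 + \sum_(x in D | ~~ c x) 2 by rewrite (bigID c).
rewrite E !sum_nat_const => /eqP; rewrite -mulnDl eqn_mul2r /= => /eqP->.
by rewrite addnn odd_double.
Qed.

(** A vertex of degree at most one is a leaf by connectivity, and deleting it lowers the degree sum
    by two. If there is none, average degree two forces 2-regularity. *)
Lemma uni_of_connected D (c : T -> bool) : (forall x y, G x y -> c x != c y) ->
  0 < #|D| -> cut_connected D -> \sum_(x in D) deg_in G D x = 2 * #|D| -> uni G D.
Proof.
move=> bip; have [k] := ubnP #|D|; elim: k D => // k IHk D; rewrite ltnS => Dk D0 conn sumD.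
have [/existsP[v /andP[vD degv]]|] := boolP [exists v in D, deg_in G D v <= 1].
  have D1 : [set v] != D.
    apply: contra_eqN sumD => /eqP <-; rewrite big_set1 cards1.
    by rewrite /deg_in big_set1 Girr.
  have [|||x [y [/set1P-> yD yv Gvy]]] := conn [set v]; rewrite ?sub1set //.
    by apply/set0Pn; exists v; rewrite set11.
  have : #|[set z in D | G v z]| == 1.
    rewrite eqn_leq -deg_inE degv deg_inE; apply/card_gt0P; exists y.
    by rewrite inE yD.
  case/cards1P => u /setP NE.
  have Nin z : (z \in D) && G v z = (z == u) by have := NE z; rewrite !inE.
  have /andP[uD Gvu] : (u \in D) && G v u by rewrite Nin.
  have uv : u != v by apply: contraTneq Gvu => ->; rewrite Girr.
  have lv : leaf G (D :\ v) v u.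
    split=> [||z]; rewrite !inE ?eqxx ?uv // => /andP[_ zD].
    by rewrite -Nin zD.
  rewrite -(setD1K vD); apply: (uni_leaf _ lv); apply: IHk.
  - by move: Dk; rewrite (cardsD1 v) vD.
  - by apply/card_gt0P; exists u; rewrite !inE uv.
  - by apply: cut_connected_leaf lv _; rewrite setD1K.
  move: sumD; rewrite (cardsD1 v) vD -{1 2}(setD1K vD).
  rewrite big_setU1 ?inE ?eqxx //= (deg_in_leaf Girr lv).
  rewrite (eq_bigr (fun x => deg_in G (D :\ v) x + (x == u))); last first.
    by move=> z; apply: deg_in_nonleaf.
  rewrite big_split /= [X in _ + (_ + X)](bigD1 u) ?inE ?uv //= eqxx.
  rewrite [X in _ + (_ + (_ + X))]big1 => [|z /andP[_ /negbTE -> //]]; lia.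
rewrite negb_exists_in => /forall_inP deg2.
have reg : forall x, x \in D -> deg_in G D x = 2.
  (* Equality in the sum of the inequalities [2 <= deg_in G D x] gives equality in each. *)
  have := @leqif_sum T (mem D) (fun x => 2 == deg_in G D x) (fun=> 2) (deg_in G D).
  case=> [x xD|_]; first by apply: leqif_eq; rewrite ltnNge deg2.
  rewrite sum_nat_const sumD mulnC eqxx => /esym/forall_inP E x xD.
  by rewrite -(eqP (E x xD)).
apply: uni_regular => //.
have /card_gt0P[x xD] := D0.
have D3 : 2 < #|D|.
  rewrite (cardsD1 x) xD ltnS -(reg x xD) deg_inE; apply/subset_leq_card/subsetP => y.
  by rewrite !inE => /andP[-> Gxy]; rewrite andbT; apply: contraTneq Gxy => ->; rewrite Girr.
(* An even size above two is four or at least six. *)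
by have := regular_bipartite_even bip reg; lia.
Qed.

End UnicyclicGraphs.

(** A set that no edge leaves is closed under [connect], hence everything or empty. *)
Lemma connected_cut (T : finType) (G : rel T) : symmetric G -> connected_graph G ->
  cut_connected G [set: T].
Proof.
move=> Gsym conn X _ /set0Pn[x xX] XT.
have /existsP[y yX] : [exists y, y \notin X].
  by rewrite -negb_forall; apply: contra XT => /forallP XT; apply/eqP/setP => z; rewrite XT inE.
have [/existsP[x' /existsP[y' /and3P[x'X y'X Gxy]]]|/existsPn noedge] :=
  boolP [exists x', exists y', [&& x' \in X, y' \notin X & G x' y']].
  by exists x', y'; split.
have cl : closed G (mem X).
  apply: intro_closed => [|x' y' Gxy x'X]; first exact: sym_connect_sym.
  apply: contraT => y'X; have := noedge x'; rewrite negb_exists => /forallP/(_ y').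
  by rewrite x'X y'X Gxy.
by have := closed_connect cl (conn x y); rewrite /= xX (negbTE yX).
Qed.

Lemma unicyclic_deg_sum (n : nat) (G : rel 'I_n) : symmetric G -> irreflexive G ->
  nedges G = n -> \sum_(x in [set: 'I_n]) deg_in G setT x = 2 * #|[set: 'I_n]|.
Proof.
move=> Gsym Girr; rewrite /nedges cardsT card_ord => En.
transitivity (\sum_(p : 'I_n * 'I_n) G p.1 p.2 : nat).
  rewrite -(pair_bigA _ (fun x y => (G x y : nat))) /=.
  by apply: eq_big => [x|x _]; rewrite ?inE // /deg_in; apply: eq_bigl => y; rewrite inE.
have half (r : rel nat) : #|[set p : 'I_n * 'I_n | r p.1 p.2 && G p.1 p.2]| =
    \sum_(p : 'I_n * 'I_n) (r p.1 p.2 && G p.1 p.2).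
  by rewrite -sum1dep_card big_mkcond; apply: eq_bigr => p _; case: ifP.
rewrite (half (fun i j => i < j)) in En; set N := (N in N = n) in En.
(* Handshake count: the pairs with [x < y] and those with [y < x] contribute equally, the diagonal
   nothing. *)
suff -> : \sum_(p : 'I_n * 'I_n) G p.1 p.2 = N + N by rewrite En addnn mul2n.
have swap_inj : injective (fun p : 'I_n * 'I_n => (p.2, p.1)) by move=> [x y] [x' y'] [-> ->].
have swapN : N = \sum_(p : 'I_n * 'I_n) ((p.2 < p.1) && G p.2 p.1).
  by rewrite /N (reindex_inj swap_inj).
rewrite {2}swapN /N -big_split /=; apply: eq_bigr => -[x y] _ /=.
rewrite [G y x]Gsym; case: (ltngtP x y) => [_|_|/val_inj ->] /=; rewrite ?addn0 ?Girr //.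
Qed.

(** Each list is completed to an enumeration of its type, and equal positions are matched. *)
Lemma bij_extension (T1 T2 : finType) (s1 : seq T1) (s2 : seq T2) : #|T1| = #|T2| ->
  uniq s1 -> uniq s2 -> size s1 = size s2 -> 0 < size s2 ->
  exists2 f : T1 -> T2, bijective f & map f s1 = s2.
Proof.
move=> cardT u1 u2 s12; case E2: s2 => [//|y0 s2'] _; rewrite -E2.
pose full (T : finType) (s : seq T) := s ++ [seq x <- enum T | x \notin s].
have full_uniq (T : finType) (s : seq T) : uniq s -> uniq (full T s).
  move=> us; rewrite cat_uniq us filter_uniq ?enum_uniq // andbT.
  by apply/hasPn => x; rewrite mem_filter => /andP[].
have full_mem (T : finType) (s : seq T) x : x \in full T s.
  by rewrite mem_cat mem_filter mem_enum andbT orbN.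
have full_size (T : finType) (s : seq T) : uniq s -> size (full T s) = #|T|.
  by move=> us; rewrite -(card_uniqP (full_uniq _ _ us)); apply: eq_card => x; rewrite full_mem.
pose f x := nth y0 (full T2 s2) (index x (full T1 s1)).
exists f.
  apply: inj_card_bij; last by rewrite cardT.
  move=> x y /eqP; rewrite nth_uniq ?full_uniq ?full_size // -?cardT -?(full_size _ s1) //;
    rewrite ?index_mem ?full_mem //.
  by move=> /eqP E; rewrite -(nth_index x (full_mem _ s1 x)) E nth_index.
apply: (@eq_from_nth _ y0) => [|i]; rewrite size_map // => i1.
have x0 : T1 by case: s1 {s12 u1 f} i1.
rewrite (nth_map x0) // /f index_cat mem_nth // index_uniq // nth_cat.
by rewrite -s12 i1.
Qed.

(** * Isomorphism invariance and uniqueness of the extremal shapes *)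

Section Transport.
Variables (T1 T2 : finType) (G1 : rel T1) (G2 : rel T2).

Lemma sun_map (f : T1 -> T2) c a w b r1 r2 x y : injective f ->
  (forall x, x \notin [:: c; a; w; b] -> f (r1 x) = r2 (f x)) ->
  sun (f c) (f a) (f w) (f b) r2 (f x) (f y) = sun c a w b r1 x y.
Proof.
move=> finj fr; rewrite /sun.
have mf z s : (f z \in map f s) = (z \in s) by apply: mem_map.
rewrite -[[:: f c; f w]]/(map f [:: c; w]) -[[:: f a; f b]]/(map f [:: a; b]).
rewrite -[[:: f c; f a; f w; f b]]/(map f [:: c; a; w; b]) !mf.
congr [|| _, _, _ | _].
  by case: (boolP (x \in [:: c; a; w; b])) => //= /fr <-; apply: inj_eq.
by case: (boolP (y \in [:: c; a; w; b])) => //= /fr <-; apply: inj_eq.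
Qed.

Lemma is_sun_transport (f : T1 -> T2) c a w b r1 r2 : bijective f ->
  (forall x y, G2 (f x) (f y) = G1 x y) ->
  (forall x, x \notin [:: c; a; w; b] -> f (r1 x) = r2 (f x)) ->
  is_sun G2 setT (f c) (f a) (f w) (f b) r2 -> is_sun G1 setT c a w b r1.
Proof.
move=> fbij fG fr [Cu _ rC GE]; have finj := bij_inj fbij.
split=> [||x _ xC|x y _ _].
- by rewrite -(map_inj_uniq finj).
- by move=> x _; rewrite in_setT.
- rewrite -(mem_map finj) fr //; apply: rC => //.
  by rewrite -[[:: f c; f a; f w; f b]]/(map f [:: c; a; w; b]) (mem_map finj).
by rewrite -fG GE ?in_setT //; apply: sun_map.
Qed.

Lemma sun_iso (f : T1 -> T2) c a w b r1 r2 : bijective f ->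
  (forall x, x \notin [:: c; a; w; b] -> f (r1 x) = r2 (f x)) ->
  is_sun G1 setT c a w b r1 -> is_sun G2 setT (f c) (f a) (f w) (f b) r2 ->
  graph_iso G1 G2.
Proof.
move=> fbij fr [_ _ _ GE1] [_ _ _ GE2]; exists f; split=> // x y.
by rewrite GE1 ?GE2 ?in_setT //; apply: sun_map => //; apply: bij_inj.
Qed.

Lemma star_transport c : graph_iso G1 G2 -> is_star G2 setT c -> exists c, is_star G1 setT c.
Proof.
move=> [f [fbij fG]] [a [w [b sD]]]; have [g gK fK] := fbij.
exists (g c), (g a), (g w), (g b); apply: (is_sun_transport fbij fG (r2 := fun=> c)).
  by move=> x _; rewrite fK.
by rewrite !fK.
Qed.

(** Any bijection matching the labelled cycles works, since all other vertices are pendants at the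
    centre. *)
Lemma star_iso c1 c2 : #|T1| = #|T2| -> is_star G1 setT c1 -> is_star G2 setT c2 ->
  graph_iso G1 G2.
Proof.
move=> cardT [a1 [w1 [b1 s1]]] [a2 [w2 [b2 s2]]]; have [[u1 _ _ _] [u2 _ _ _]] := (s1, s2).
have [f fbij [fc fa fw fb]] := bij_extension cardT u1 u2 erefl isT.
apply: (sun_iso fbij (r1 := fun=> c1) (r2 := fun=> c2) _ s1); first by [].
by rewrite fc fa fw fb.
Qed.

Lemma sun_with_transport (f : T1 -> T2) c a w b p q : bijective f ->
  (forall x y, G2 (f x) (f y) = G1 x y) ->
  sun_with G2 setT (f c) (f a) (f w) (f b) (f p) (f q) -> sun_with G1 setT c a w b p q.
Proof.
move=> fbij fG [_ pC qC sD]; have finj := bij_inj fbij.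
split; rewrite ?in_setT ?(mem_map finj) //.
- by rewrite -(mem_map finj).
- by rewrite -(mem_map finj).
apply: is_sun_transport sD => // x _; rewrite (inj_eq finj); by case: eqP.
Qed.

Lemma sun_with_iso (f : T1 -> T2) c a w b p q : bijective f ->
  sun_with G1 setT c a w b p q -> sun_with G2 setT (f c) (f a) (f w) (f b) (f p) (f q) ->
  graph_iso G1 G2.
Proof.
move=> fbij [_ _ _ s1] [_ _ _ s2]; apply: sun_iso s1 s2 => // x _.
by rewrite (inj_eq (bij_inj fbij)); case: eqP.
Qed.

Lemma sun_with_uniq (T : finType) (G : rel T) c a w b p q :
  sun_with G setT c a w b p q -> uniq [:: p; c; a; w; b].
Proof. by move=> [_ pC _ [Cu _ _ _]]; rewrite cons_uniq pC. Qed.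

Lemma opp_sun_transport c : graph_iso G1 G2 -> is_opp_sun G2 setT c ->
  exists c, is_opp_sun G1 setT c.
Proof.
move=> [f [fbij fG]] [a [w [b [p sD]]]]; have [g gK fK] := fbij.
by exists (g c), (g a), (g w), (g b), (g p); apply: (sun_with_transport fbij fG); rewrite !fK.
Qed.

Lemma adj_sun_transport c : graph_iso G1 G2 -> is_adj_sun G2 setT c ->
  exists c, is_adj_sun G1 setT c.
Proof.
move=> [f [fbij fG]] [a [w [b [p sD]]]]; have [g gK fK] := fbij.
by exists (g c), (g a), (g w), (g b), (g p); apply: (sun_with_transport fbij fG); rewrite !fK.
Qed.

Lemma opp_sun_iso c1 c2 : #|T1| = #|T2| -> is_opp_sun G1 setT c1 -> is_opp_sun G2 setT c2 ->
  graph_iso G1 G2.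
Proof.
move=> cardT [a1 [w1 [b1 [p1 s1]]]] [a2 [w2 [b2 [p2 s2]]]].
have [f fbij [fp fc fa fw fb]] :=
  bij_extension cardT (sun_with_uniq s1) (sun_with_uniq s2) erefl isT.
by apply: (sun_with_iso fbij s1); rewrite fp fc fa fw fb.
Qed.

Lemma adj_sun_iso c1 c2 : #|T1| = #|T2| -> is_adj_sun G1 setT c1 -> is_adj_sun G2 setT c2 ->
  graph_iso G1 G2.
Proof.
move=> cardT [a1 [w1 [b1 [p1 s1]]]] [a2 [w2 [b2 [p2 s2]]]].
have [f fbij [fp fc fa fw fb]] :=
  bij_extension cardT (sun_with_uniq s1) (sun_with_uniq s2) erefl isT.
by apply: (sun_with_iso fbij s1); rewrite fp fc fa fw fb.
Qed.

End Transport.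

(** * The concrete graphs have the extremal shapes *)

Lemma mem_attach0 i s c x y :
  ((x, y) \in attach i s 0 c) = (x == i) && (c <= y < c + s).
Proof.
rewrite /attach cats0; apply/mapP/andP => [[j]|[/eqP-> ycs]].
  by rewrite mem_iota => js [-> ->]; rewrite eqxx; split=> //; lia.
by exists (y - c); rewrite ?mem_iota; [lia | congr (_, _); lia].
Qed.

Lemma mem_C4edges0 s1 s2 s3 s4 x y :
  ((x, y) \in C4edges s1 0 s2 0 s3 0 s4 0) =
  [|| (x, y) \in [:: (0, 1); (1, 2); (2, 3); (3, 0)],
      (x == 0) && (4 <= y < 4 + s1), (x == 1) && (4 + s1 <= y < 4 + s1 + s2),
      (x == 2) && (4 + s1 + s2 <= y < 4 + s1 + s2 + s3)
    | (x == 3) && (4 + s1 + s2 + s3 <= y < 4 + s1 + s2 + s3 + s4)].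
Proof. by rewrite /C4edges !addn0 -!mem_attach0 !mem_cat. Qed.

Lemma B2_star n : 4 <= n -> exists c, is_star (Bgraph 2 (n - 2)) setT c.
Proof.
move=> n4; have sz : C4size 0 0 (n - 2 - 2) 0 0 0 0 0 = n by rewrite /C4size; lia.
have lt k : k < 4 -> k < C4size 0 0 (n - 2 - 2) 0 0 0 0 0 by rewrite sz; lia.
(* The [n-4] pendants hang at vertex 1, whose opposite vertex is 3. *)
exists (Ordinal (lt 1 isT)), (Ordinal (lt 0 isT)), (Ordinal (lt 3 isT)), (Ordinal (lt 2 isT)).
split=> [|z _|x _ _|x y _ _]; rewrite ?in_setT //.
rewrite /Bgraph /C4graph !mem_C4edges0 /sun !inE -!val_eqE /=.
move: (ltn_ord x) (ltn_ord y); move: (nat_of_ord x) (nat_of_ord y) => {}x {}y.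
rewrite /C4size !xpair_eqE.
by case: x => [|[|[|[|x]]]]; case: y => [|[|[|[|y]]]] //=; clear; lia.
Qed.

Lemma C4_opp_sun n : 6 <= n -> exists c, is_opp_sun (C4graph 1 0 0 0 (n - 5) 0 0 0) setT c.
Proof.
move=> n4; have sz : C4size 1 0 0 0 (n - 5) 0 0 0 = n by rewrite /C4size; lia.
have lt k : k < 5 -> k < C4size 1 0 0 0 (n - 5) 0 0 0 by rewrite sz; lia.
(* Vertex 2 carries [n-5] pendants; vertex 4 is the single pendant at the opposite vertex 0. *)
exists (Ordinal (lt 2 isT)), (Ordinal (lt 1 isT)), (Ordinal (lt 0 isT)), (Ordinal (lt 3 isT)).
exists (Ordinal (lt 4 isT)); split=> //.
split=> [|z _|x _ _|x y _ _]; rewrite ?in_setT //; first by case: eqP; rewrite !inE eqxx ?orbT.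
rewrite /C4graph !mem_C4edges0 /sun !inE -!val_eqE /= !(fun_if val) /=.
move: (ltn_ord x) (ltn_ord y); move: (nat_of_ord x) (nat_of_ord y) => {}x {}y.
rewrite /C4size !xpair_eqE.
by case: x => [|[|[|[|[|x]]]]]; case: y => [|[|[|[|[|y]]]]] //=; clear; lia.
Qed.

Lemma B3_adj_sun n : 6 <= n -> exists c, is_adj_sun (Bgraph 3 (n - 3)) setT c.
Proof.
move=> n4; have sz : C4size 1 0 (n - 3 - 2) 0 0 0 0 0 = n by rewrite /C4size; lia.
have lt k : k < 5 -> k < C4size 1 0 (n - 3 - 2) 0 0 0 0 0 by rewrite sz; lia.
(* Vertex 1 carries [n-5] pendants; vertex 4 is the single pendant at its neighbour 0. *)
exists (Ordinal (lt 1 isT)), (Ordinal (lt 0 isT)), (Ordinal (lt 3 isT)), (Ordinal (lt 2 isT)).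
exists (Ordinal (lt 4 isT)); split=> //.
split=> [|z _|x _ _|x y _ _]; rewrite ?in_setT //; first by case: eqP; rewrite !inE eqxx ?orbT.
rewrite /Bgraph /C4graph !mem_C4edges0 /sun !inE -!val_eqE /= !(fun_if val) /=.
move: (ltn_ord x) (ltn_ord y); move: (nat_of_ord x) (nat_of_ord y) => {}x {}y.
rewrite /C4size !xpair_eqE.
by case: x => [|[|[|[|[|x]]]]]; case: y => [|[|[|[|[|y]]]]] //=; clear; lia.
Qed.

(** * Removing the signs and assembling the three bounds *)

Local Open Scope ring_scope.

Lemma per_laplacian_bipartite (n : nat) (G : rel 'I_n) : irreflexive G -> bipartite G ->
  per (laplacian G) = Posz (lap_per G setT setT).
Proof.
move=> Girr [c bip]; pose e (i : 'I_n) : int := (-1) ^+ c i.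
have lapE i j : laplacian G i j = e i * e j * (abs_lap G setT i j)%:R.
  rewrite /laplacian mxE /abs_lap; have [<-|_] := eqVneq i j.
    rewrite /e -expr2 sqrr_sign mul1r natz /deg /deg_in -sum1dep_card big_mkcond.
    by congr Posz; apply: eq_big => [x|x _]; rewrite ?inE //; case: (G i x).
  case Gij: (G i j); last by rewrite mulr0 oppr0.
  by have := bip _ _ Gij; rewrite /e; case: (c i); case: (c j).
rewrite /per /lap_per /sub_per -natz natr_sum.
apply: eq_big => [s|s _]; first by apply/esym/subsetP => x; rewrite !inE.
rewrite natr_prod (eq_bigl xpredT) => [|i]; last by rewrite inE.
rewrite (eq_bigr _ (fun i _ => lapE i (s i))) !big_split /=.
(* Reindexing by [s] makes the row signs and column signs the same product, so they cancel in
   squares. *)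
rewrite -(reindex_inj (@perm_inj _ s) (P := xpredT) (F := e)) /=.
rewrite -big_split /= big1 ?mul1r // => i _.
by rewrite /e -expr2 sqrr_sign.
Qed.

Theorem theorem3p9 (n : nat) (G : rel 'I_n) :
  (4 <= n)%N -> simple_graph G -> bipartite G -> unicyclic G ->
  [/\ 24 * Posz n - 60 <= per (laplacian G)
        /\ (per (laplacian G) = 24 * Posz n - 60 <-> graph_iso G (Bgraph 2 (n - 2)%N)),
      (6 <= n)%N -> ~ graph_iso G (Bgraph 2 (n - 2)%N) ->
        40 * Posz n - 140 <= per (laplacian G)
        /\ (per (laplacian G) = 40 * Posz n - 140 <->
            graph_iso G (C4graph 1 0 0 0 (n - 5)%N 0 0 0))
    & (6 <= n)%N -> ~ graph_iso G (Bgraph 2 (n - 2)%N) ->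
        ~ graph_iso G (C4graph 1 0 0 0 (n - 5)%N 0 0 0) ->
        44 * Posz n - 160 <= per (laplacian G)
        /\ (per (laplacian G) = 44 * Posz n - 160 <-> graph_iso G (Bgraph 3 (n - 3)%N))].
Proof.
move=> n4 [Gsym Girr'] Gbip [conn En].
have Girr x : G x x = false by apply: negbTE.
have cardT : #|[set: 'I_n]| = n by rewrite cardsT card_ord.
have uniG : uni G [set: 'I_n].
  have [c bip] := Gbip; apply: (uni_of_connected Gsym Girr bip).
  - by rewrite cardT; lia.
  - exact: connected_cut.
  - exact: unicyclic_deg_sum.
have card_C4 s1 k1 s2 k2 s3 k3 s4 k4 : C4size s1 k1 s2 k2 s3 k3 s4 k4 = n ->
    #|'I_n| = #|'I_(C4size s1 k1 s2 k2 s3 k3 s4 k4)| by rewrite !card_ord => ->.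
have starE : (exists c, is_star G setT c) <-> graph_iso G (Bgraph 2 (n - 2)).
  have [c' st] := B2_star n4; split=> [[c sG]|iso]; last exact: star_transport iso st.
  by apply: star_iso sG st; apply: card_C4; rewrite /C4size; lia.
have oppE : (6 <= n)%N ->
    (exists c, is_opp_sun G setT c) <-> graph_iso G (C4graph 1 0 0 0 (n - 5) 0 0 0).
  move=> n6; have [c' st] := C4_opp_sun n6.
  split=> [[c sG]|iso]; last exact: opp_sun_transport iso st.
  by apply: opp_sun_iso sG st; apply: card_C4; rewrite /C4size; lia.
have adjE : (6 <= n)%N ->
    (exists c, is_adj_sun G setT c) <-> graph_iso G (Bgraph 3 (n - 3)).
  move=> n6; have [c' st] := B3_adj_sun n6.
  split=> [[c sG]|iso]; last exact: adj_sun_transport iso st.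
  by apply: adj_sun_iso sG st; apply: card_C4; rewrite /C4size; lia.
rewrite (per_laplacian_bipartite Girr Gbip); set L := lap_per G _ _.
have star_val : (exists c, is_star G setT c) -> (L + 60 = 24 * n)%N.
  by move=> [c /(star_lap Gsym Girr)[]]; rewrite cardT.
have opp_val : (exists c, is_opp_sun G setT c) -> (L + 140 = 40 * n)%N.
  by move=> [c /(opp_sun_lap Gsym Girr)[]]; rewrite cardT.
have adj_val : (exists c, is_adj_sun G setT c) -> (L + 160 = 44 * n)%N.
  by move=> [c /(adj_sun_lap Gsym Girr)[]]; rewrite cardT.
have tri : (exists c, is_star G setT c) \/ (6 <= n)%N /\
    [\/ exists c, is_opp_sun G setT c, exists c, is_adj_sun G setT c
      | (44 * n <= L + 159)%N].
  by have := uni_lap_trichotomy Gsym Girr uniG; rewrite cardT.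
move: (L) star_val opp_val adj_val tri => {}L star_val opp_val adj_val tri.
split=> [|n6 nB|n6 nB nC].
- rewrite -starE; case: tri => [s|[n6 tri]].
    have := star_val s; split; first by lia.
    by split=> // _; lia.
  (* All three formulas equal 60 at [n = 5]; from [n = 6] on they are strictly ordered. *)
  have big : (24 * n < L + 60)%N.
    by case: tri => [/opp_val|/adj_val|]; lia.
  by split; [lia | split=> [E|/star_val]; [exfalso|]; lia].
- rewrite -(oppE n6); case: tri => [/starE //|[_ tri]].
  case: tri => [s|/adj_val v|v].
  + have := opp_val s; split; first by lia.
    by split=> // _; lia.
  + by split; [lia | split=> [E|/opp_val]; [exfalso|]; lia].
  + by split; [lia | split=> [E|/opp_val]; [exfalso|]; lia].
- rewrite -(adjE n6); case: tri => [/starE //|[_ [/(oppE n6) //|s|v]]].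
    have := adj_val s; split; first by lia.
    by split=> // _; lia.
  by split; [lia | split=> [E|/adj_val]; [exfalso|]; lia].
Qed.
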